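(* Let $C\in\left(\frac{4}{3^{3/2}},\infty\right)$ and consider the Riemannian surface $(D_C,g_C)$, where $D_C=(\xi_{01},\xi_{02})\times\mathbb{R}$. Then $(D_C,g_C)$ is the universal cover of the surface of revolution in $\mathbb{R}^3$ given by $$\Psi_{C,C^\ast}(\xi,\theta)=\left(f(\xi)\cos\frac{\theta}{C^\ast},\ f(\xi)\sin\frac{\theta}{C^\ast},\ h(\xi)\right),\qquad (\xi,\theta)\in D_C,$$ where $f(\xi)=\dfrac{C^\ast}{\xi}$, $$h(\xi)=\pm\int_{\xi_{00}}^{\xi}\sqrt{\frac{3\tau^2-(C^\ast)^2\left(-\tau^{8/3}+3C\tau^2-3\right)}{\tau^4\left(-\tau^{8/3}+3C\tau^2-3\right)}}\,d\tau+a,$$ $C^\ast\in\left(0,\left(C-\frac{4}{3^{3/2}}\right)^{-1/2}\right)$ is a positive constant, $a$ is a real constant and $\xi_{00}$ is an arbitrary point in $(\xi_{01},\xi_{02})$.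
   Context: For $C>\frac{4}{3^{3/2}}$ the function $T(\xi)=-\xi^{8/3}+3C\xi^2-3$, $\xi>0$, has exactly two positive zeros $0<\xi_{01}<\xi_{02}$ and is positive on $(\xi_{01},\xi_{02})$. $D_C=(\xi_{01},\xi_{02})\times\mathbb{R}$, with coordinates $(\xi,\theta)$, carries the Riemannian metric $$g_C=\frac{3}{\xi^2(-\xi^{8/3}+3C\xi^2-3)}\,d\xi^2+\frac{1}{\xi^2}\,d\theta^2 .$$ The surface of revolution given by $\Psi_{C,C^\ast}$ is the image of $\Psi_{C,C^\ast}$ with the metric induced from the Euclidean metric of $\mathbb{R}^3$, and ''universal cover'' is understood in the Riemannian sense (the simply connected surface covers it by a local isometry). *)

(* Defs.v *)
From Stdlib Require Import Reals.
From Coquelicot Require Import Coquelicot.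
Open Scope R_scope.

Notation plane := (R * R)%type.
Notation space := (R * R * R)%type.

Definition image {X Y : Type} (A : X -> Prop) (f : X -> Y) : Y -> Prop :=
  fun y => exists x, A x /\ f x = y.

Definition rel_open {X : UniformSpace} (A U : X -> Prop) : Prop :=
  exists O : X -> Prop, open O /\ forall x, U x <-> A x /\ O x.

Definition homeomorphism {X Y : UniformSpace}
    (A : X -> Prop) (B : Y -> Prop) (f : X -> Y) : Prop :=
  (forall x, A x -> B (f x)) /\ continuous_on A f /\
  exists k : Y -> X,
    (forall y, B y -> A (k y)) /\ continuous_on B k /\
    (forall x, A x -> k (f x) = x) /\ (forall y, B y -> f (k y) = y).

Definition covering_map {X Y : UniformSpace}
    (A : X -> Prop) (B : Y -> Prop) (p : X -> Y) : Prop :=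
  (forall x, A x -> B (p x)) /\
  (forall y, B y -> exists x, A x /\ p x = y) /\
  continuous_on A p /\
  forall y, B y -> exists V : Y -> Prop,
    rel_open B V /\ V y /\
    exists (I : Type) (W : I -> X -> Prop),
      (forall i, rel_open A (W i)) /\
      (forall i j x, W i x -> W j x -> i = j) /\
      (forall x, A x /\ V (p x) <-> exists i, W i x) /\
      (forall i, homeomorphism (W i) V p).

Definition unit_interval (t : R) : Prop := 0 <= t <= 1.

Definition unit_square (q : plane) : Prop :=
  unit_interval (fst q) /\ unit_interval (snd q).

Definition path_connected {X : UniformSpace} (A : X -> Prop) : Prop :=
  forall x y, A x -> A y ->
  exists c : R -> X,
    continuous_on unit_interval c /\ (forall t, unit_interval t -> A (c t)) /\
    c 0 = x /\ c 1 = y.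

Definition simply_connected {X : UniformSpace} (A : X -> Prop) : Prop :=
  (exists x, A x) /\ path_connected A /\
  forall c : R -> X,
    continuous_on unit_interval c -> (forall t, unit_interval t -> A (c t)) ->
    c 0 = c 1 ->
    exists H : plane -> X,
      continuous_on unit_square H /\ (forall q, unit_square q -> A (H q)) /\
      (forall t, unit_interval t -> H (0, t) = c t) /\
      (forall t, unit_interval t -> H (1, t) = c 0) /\
      (forall r, unit_interval r -> H (r, 0) = c 0 /\ H (r, 1) = c 0).

(* C^infinity on U, meant for open U: partial derivatives of all orders exist
   and are continuous at every point of U. *)
Definition smooth_on (U : plane -> Prop) (f : R -> R -> R) : Prop :=
  forall (n : nat) (x y : R), U (x, y) -> ex_diff_n f n x y.

Definition smooth_map_on (U : plane -> Prop) (F : plane -> space) : Prop :=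
  smooth_on U (fun x y => fst (fst (F (x, y)))) /\
  smooth_on U (fun x y => snd (fst (F (x, y)))) /\
  smooth_on U (fun x y => snd (F (x, y))).

Definition dot (u v : space) : R :=
  fst (fst u) * fst (fst v) + snd (fst u) * snd (fst v) + snd u * snd v.

(* An embedded smooth surface of R^3 (without boundary), always equipped with
   the metric induced by the Euclidean product [dot]. *)
Definition regular_surface (S : space -> Prop) : Prop :=
  forall q, S q ->
  exists (U : plane -> Prop) (V : space -> Prop) (F : plane -> space),
    open U /\ open V /\ V q /\
    homeomorphism U (fun y => S y /\ V y) F /\
    smooth_map_on U F /\
    forall x, U x -> exists L : plane -> space,
      filterdiff F (locally x) L /\ forall u v, L u = L v -> u = v.

(* E dx^2 + 2 F dx dy + G dy^2 *)
Record metric := Metric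
  { coefE : R -> R -> R; coefF : R -> R -> R; coefG : R -> R -> R }.

Definition metric_at (g : metric) (p u v : plane) : R :=
  let x := fst p in let y := snd p in
  coefE g x y * (fst u * fst v)
  + coefF g x y * (fst u * snd v + snd u * fst v)
  + coefG g x y * (snd u * snd v).

Definition riemannian_metric_on (D : plane -> Prop) (g : metric) : Prop :=
  smooth_on D (coefE g) /\ smooth_on D (coefF g) /\ smooth_on D (coefG g) /\
  forall p u, D p -> u <> (0, 0) -> 0 < metric_at g p u u.

Definition isometric_on (D : plane -> Prop) (g : metric) (p : plane -> space) :
    Prop :=
  forall x, D x -> exists L : plane -> space,
    filterdiff p (locally x) L /\
    forall u v, dot (L u) (L v) = metric_at g x u v.

(* The Riemannian surface (D, g) is the universal cover of the surface S, with
   projection p.  Since S is embedded, smoothness of p into S is smoothness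
   into R^3; and as g is positive definite, an isometric p has injective
   differential, so it is a local diffeomorphism onto S. *)
Definition riemannian_universal_cover
    (D : plane -> Prop) (g : metric) (S : space -> Prop) (p : plane -> space) :
    Prop :=
  open D /\ riemannian_metric_on D g /\ regular_surface S /\
  simply_connected D /\ covering_map D S p /\
  smooth_map_on D p /\ isometric_on D g p.

Definition T (C xi : R) : R := - Rpower xi (8 / 3) + 3 * C * xi ^ 2 - 3.

Definition C_min : R := 4 / Rpower 3 (3 / 2).

Definition strip (x1 x2 : R) (p : plane) : Prop := x1 < fst p < x2.

Definition g_C (C : R) : metric :=
  Metric (fun xi _ => 3 / (xi ^ 2 * T C xi)) (fun _ _ => 0)
         (fun xi _ => 1 / xi ^ 2).

Definition f (Cs xi : R) : R := Cs / xi.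

(* [RInt] is oriented, so this is also the intended value for xi < xi00; the
   number sgn, 1 or -1, is the choice of sign in front of the integral. *)
Definition h (C Cs xi00 sgn a xi : R) : R :=
  sgn * RInt (fun tau => sqrt ((3 * tau ^ 2 - Cs ^ 2 * T C tau)
                               / (tau ^ 4 * T C tau))) xi00 xi + a.

Definition Psi (C Cs xi00 sgn a : R) (p : plane) : space :=
  let xi := fst p in let theta := snd p in
  (f Cs xi * cos (theta / Cs), f Cs xi * sin (theta / Cs),
   h C Cs xi00 sgn a xi).

(* Main.v *)
Require Import Defs.
From Stdlib Require Import Reals.
From Coquelicot Require Import Coquelicot.
From Stdlib Require Import Lra Lia ZArith.
Open Scope R_scope.

(** The map [Psi] is a surface of revolution whose profile curve is
    [(Cs / x, h x)].  Its first fundamental form is always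
    [((Cs / x ^ 2) ^ 2 + h' x ^ 2) dx ^ 2 + dy ^ 2 / x ^ 2]
    ([revolution_isometric]), and the integrand defining [h] is chosen so that the
    first coefficient is [3 / (x ^ 2 * T C x)].  For this to make sense the radicand
    must be positive on the strip, so that its square root is smooth.  That has two
    halves: [T] is positive between its zeros ([T_pos]), because in the variable
    [u = x ^ (2 / 3)] it is a quartic with [T / u ^ 3] concave; and
    [Cs ^ 2 * T C x < 3 * x ^ 2] ([radicand_pos]), because the maximum of
    [T C x / x ^ 2] is [3 * (C - C_min)] ([T_le]).

    The topology holds for any smooth profile [(Cs / x, z x)].  The distance [Cs / x]
    to the axis determines [x], and the polar angle determines [y / Cs] up to
    multiples of [2 * PI].  Hence over a half space bounded by a plane through the
    axis the map has continuous inverses, one for each full turn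
    ([sheet_homeomorphism]).  A single inverse is a chart of the embedded surface
    ([revolution_regular]), and all of them together show that the map is a covering
    ([revolution_covering]).  The strip is convex, hence simply connected
    ([simply_connected_strip]). *)

(** * Positivity of T and of the radicand *)

Lemma Rpower_two_thirds (x : R) (hx : 0 < x) :
  Rpower x (2 / 3) ^ 3 = x ^ 2 /\ Rpower x (2 / 3) ^ 4 = Rpower x (8 / 3).
Proof.
  rewrite <- !Rpower_pow, !Rpower_mult by (try apply exp_pos; assumption).
  split; f_equal; simpl; field.
Qed.

Lemma T_quartic (C x : R) (hx : 0 < x) :
  T C x = - Rpower x (2 / 3) ^ 4 + 3 * C * Rpower x (2 / 3) ^ 3 - 3.
Proof.
  unfold T. destruct (Rpower_two_thirds x hx) as [-> ->]. reflexivity.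
Qed.

(** Divided by [u ^ 3], the quartic becomes [3 * C - (u + 3 / u ^ 3)], which is
    concave, so it is positive between two zeros.  To avoid calculus, the two
    equations are used to eliminate [C] (this is [K]), after which the quartic
    factors as [(u - u1) * (u2 - u)] times a sum of positive terms. *)
Lemma quartic_pos_between_zeros (C u1 u2 u : R) (h1 : 0 < u1)
  (hu : u1 < u < u2)
  (e1 : - u1 ^ 4 + 3 * C * u1 ^ 3 - 3 = 0)
  (e2 : - u2 ^ 4 + 3 * C * u2 ^ 3 - 3 = 0) :
  0 < - u ^ 4 + 3 * C * u ^ 3 - 3.
Proof.
  assert (Hu : 0 < u) by lra. assert (H2 : 0 < u2) by lra.
  assert (H1c : 0 < u1 ^ 3) by (apply pow_lt; lra).
  assert (H2c : 0 < u2 ^ 3) by (apply pow_lt; lra).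
  assert (K : u1 ^ 3 * u2 ^ 3 = 3 * (u1 ^ 2 + u1 * u2 + u2 ^ 2)).
  { apply (Rmult_eq_reg_l (u2 - u1)); [|lra].
    assert (E : u2 ^ 3 * (- u1 ^ 4 + 3 * C * u1 ^ 3 - 3)
                - u1 ^ 3 * (- u2 ^ 4 + 3 * C * u2 ^ 3 - 3) = 0)
      by (rewrite e1, e2; ring).
    ring_simplify in E. ring_simplify. lra. }
  assert (E : u1 ^ 3 * u2 ^ 3 * (- u ^ 4 + 3 * C * u ^ 3 - 3)
    = 3 * (u - u1) * (u2 - u)
      * (u ^ 2 * u2 ^ 2 + u * u1 * u2 * (u2 + u)
         + u1 ^ 2 * (u2 ^ 2 + u2 * u + u ^ 2))).
  { replace (u1 ^ 3 * u2 ^ 3 * (- u ^ 4 + 3 * C * u ^ 3 - 3)) with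
      (u2 ^ 3 * ((u - u1) * (3 * (u ^ 2 + u * u1 + u1 ^ 2)))
       - (u - u1) * u ^ 3 * (u1 ^ 3 * u2 ^ 3)
       + u ^ 3 * u2 ^ 3 * (- u1 ^ 4 + 3 * C * u1 ^ 3 - 3)) by ring.
    rewrite K, e1. ring. }
  apply (Rmult_lt_reg_l (u1 ^ 3 * u2 ^ 3)); [nra|].
  rewrite E, Rmult_0_r.
  repeat apply Rmult_lt_0_compat; try lra.
  assert (0 < u * u1) by nra.
  assert (0 < u * u1 * u2) by nra.
  assert (0 < u1 ^ 2) by nra. assert (0 < u2 * u) by nra.
  assert (0 < u * u1 * u2 * (u2 + u)) by nra.
  assert (0 <= u ^ 2 * u2 ^ 2) by nra.
  assert (0 < u2 ^ 2 + u2 * u + u ^ 2) by nra.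
  nra.
Qed.

Lemma T_pos (C x1 x2 x : R) (h1 : 0 < x1) (hx : x1 < x < x2)
  (e1 : T C x1 = 0) (e2 : T C x2 = 0) : 0 < T C x.
Proof.
  rewrite T_quartic in e1 by lra. rewrite T_quartic in e2 by lra.
  rewrite T_quartic by lra.
  apply (quartic_pos_between_zeros C (Rpower x1 (2 / 3)) (Rpower x2 (2 / 3)));
    try assumption.
  - apply exp_pos.
  - split; apply Rlt_Rpower_l; lra.
Qed.

(** Equality holds where [T C x / x ^ 2] is maximal, at [x ^ (2 / 3) = sqrt 3]:
    the difference of the two sides is a quartic in [x ^ (2 / 3)] with a double
    root there.  This is where the constant [C_min] comes from. *)
Lemma T_le (C x : R) (hx : 0 < x) : T C x <= 3 * (C - C_min) * x ^ 2.
Proof.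
  rewrite T_quartic by assumption.
  destruct (Rpower_two_thirds x hx) as [<- _].
  set (u := Rpower x (2 / 3)).
  assert (Hu : 0 < u) by apply exp_pos.
  set (s := sqrt 3).
  assert (Hs : s * s = 3) by (apply sqrt_sqrt; lra).
  assert (Hs0 : 0 < s) by (apply sqrt_lt_R0; lra).
  assert (Hc : C_min = 4 * s / 9).
  { unfold C_min. replace (3 / 2) with (1 + / 2) by field.
    rewrite Rpower_plus, Rpower_1, Rpower_sqrt by lra. fold s.
    apply (Rmult_eq_reg_r (9 * s)); [|lra].
    replace (4 * s / 9 * (9 * s)) with (4 * (s * s)) by field.
    rewrite Hs. field; lra. }
  assert (E : 3 * (C - C_min) * u ^ 3 - (- u ^ 4 + 3 * C * u ^ 3 - 3)
              = (u - s) ^ 2 * (u ^ 2 + 2 * s / 3 * u + 1)).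
  { rewrite Hc.
    transitivity (u ^ 4 - 4 * s / 3 * u ^ 3 + 3); [field|].
    transitivity (u ^ 4 - 4 * s / 3 * u ^ 3 + s * s
       + u ^ 2 * (1 - s * s / 3) + u * s * 2 * (s * s / 3 - 1)); [|field].
    rewrite Hs. field. }
  assert (0 <= (u - s) ^ 2 * (u ^ 2 + 2 * s / 3 * u + 1)); [|lra].
  apply Rmult_le_pos; [apply pow2_ge_0|].
  assert (0 < s * u) by (apply Rmult_lt_0_compat; assumption).
  pose proof (pow2_ge_0 u). lra.
Qed.

(** The bound on [Cs] says [Cs ^ 2 * (C - C_min) < 1], which by [T_le] is exactly
    what keeps the expression under the root in [h] positive. *)
Lemma radicand_pos (C Cs x : R) (hC : C_min < C)
  (hCs : 0 < Cs < Rpower (C - C_min) (- (1 / 2))) (hx : 0 < x) :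
  0 < 3 * x ^ 2 - Cs ^ 2 * T C x.
Proof.
  set (d := C - C_min) in *.
  assert (Hd : 0 < d) by (unfold d; lra).
  assert (Hq : Rpower d (- (1 / 2)) * Rpower d (- (1 / 2)) = / d).
  { rewrite <- Rpower_plus.
    replace (- (1 / 2) + - (1 / 2)) with (- (1)) by field.
    rewrite Rpower_Ropp, Rpower_1; auto. }
  assert (K : Cs ^ 2 * d < 1).
  { apply (Rmult_lt_reg_r (/ d)); [now apply Rinv_0_lt_compat|].
    rewrite Rmult_assoc, Rinv_r, Rmult_1_l, Rmult_1_r, <- Hq by lra. nra. }
  pose proof (T_le C x hx) as B. fold d in B.
  assert (0 < x ^ 2) by nra. assert (0 < Cs ^ 2) by nra.
  assert (Cs ^ 2 * T C x <= Cs ^ 2 * (3 * d * x ^ 2))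
    by (apply Rmult_le_compat_l; lra).
  nra.
Qed.

(** * Functions of class C^n *)

(** [a] is of class C^n on [I].  The derivative is an existential witness, not
    the iterated [Derive_n], so that closure under products and powers is an
    induction on [n] without Leibniz or chain rules of higher order. *)
Fixpoint class_C (I : R -> Prop) (n : nat) (a : R -> R) : Prop :=
  match n with
  | O => forall x, I x -> continuous a x
  | S m => exists a' : R -> R,
      (forall x, I x -> is_derive a x (a' x)) /\ class_C I m a'
  end.

Lemma is_derive_continuous (a : R -> R) (x l : R) :
  is_derive a x l -> continuous a x.
Proof. intros H. apply (ex_derive_continuous a). now exists l. Qed.

Lemma class_C_pred (I : R -> Prop) (n : nat) :
  forall a, class_C I (S n) a -> class_C I n a.
Proof.
  induction n as [|n IH]; intros a [a' [Ha Ha']].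
  - intros x Hx. exact (is_derive_continuous _ _ _ (Ha x Hx)).
  - exists a'. auto.
Qed.

Lemma class_C_continuous (I : R -> Prop) (n : nat) (a : R -> R) (x : R) :
  class_C I n a -> I x -> continuous a x.
Proof.
  destruct n as [|n]; [auto|]. intros [a' [Ha _]] Hx.
  exact (is_derive_continuous _ _ _ (Ha x Hx)).
Qed.

Lemma class_C_ext (I : R -> Prop) (n : nat) (a b : R -> R) :
  open I -> (forall x, I x -> a x = b x) -> class_C I n a -> class_C I n b.
Proof.
  intros HI E.
  assert (L : forall x, I x -> locally x (fun y => a y = b y))
    by (intros x Hx; apply (filter_imp _ _ E), HI, Hx).
  destruct n as [|n].
  - intros Ha x Hx. apply (continuous_ext_loc _ a); auto.
  - intros [a' [Ha Ha']]. exists a'. split; [|exact Ha'].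
    intros x Hx. apply (is_derive_ext_loc a); auto.
Qed.

Lemma class_C_const (I : R -> Prop) (n : nat) :
  forall c, class_C I n (fun _ => c).
Proof.
  induction n as [|n IH]; intros c.
  - intros x _. apply continuous_const.
  - exists (fun _ => 0). split; [|apply IH].
    intros x _. apply @is_derive_const.
Qed.

Lemma class_C_id (I : R -> Prop) (n : nat) : class_C I n (fun x => x).
Proof.
  destruct n as [|n].
  - intros x _. apply continuous_id.
  - exists (fun _ => 1). split; [|apply class_C_const].
    intros x _. apply @is_derive_id.
Qed.

Lemma class_C_plus (I : R -> Prop) (n : nat) :
  forall a b, class_C I n a -> class_C I n b -> class_C I n (fun x => a x + b x).
Proof.
  induction n as [|n IH]; intros a b.
  - intros Ha Hb x Hx. apply @continuous_plus; auto.
  - intros [a' [Ha Ha']] [b' [Hb Hb']].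
    exists (fun x => a' x + b' x). split; [|auto].
    intros x Hx. apply @is_derive_plus; auto.
Qed.

Lemma class_C_mult (I : R -> Prop) (n : nat) :
  forall a b, class_C I n a -> class_C I n b -> class_C I n (fun x => a x * b x).
Proof.
  induction n as [|n IH]; intros a b.
  - intros Ha Hb x Hx. apply @continuous_mult; auto.
  - intros Ha Hb.
    pose proof (class_C_pred _ _ _ Ha) as Ha0.
    pose proof (class_C_pred _ _ _ Hb) as Hb0.
    destruct Ha as [a' [Ha Ha']]. destruct Hb as [b' [Hb Hb']].
    exists (fun x => a' x * b x + a x * b' x).
    split; [|apply class_C_plus; auto].
    intros x Hx. apply @is_derive_mult; auto. intros; apply Rmult_comm.
Qed.

Lemma is_derive_Rpower_comp (a : R -> R) (x l p : R) :
  is_derive a x l -> 0 < a x ->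
  is_derive (fun y => Rpower (a y) p) x (p * Rpower (a x) (p - 1) * l).
Proof.
  intros Ha Hp. rewrite Rmult_comm.
  apply (is_derive_comp (fun y => Rpower y p) a); [|exact Ha].
  apply is_derive_Reals, derivable_pt_lim_power, Hp.
Qed.

(** All exponents are treated at once, because the derivative of [a ^ p]
    contains [a ^ (p - 1)]; inverses and square roots are special cases. *)
Lemma class_C_Rpower (I : R -> Prop) (n : nat) (a : R -> R) :
  (forall x, I x -> 0 < a x) -> class_C I n a ->
  forall p, class_C I n (fun x => Rpower (a x) p).
Proof.
  intros Hpos. induction n as [|n IH]; intros Ha p.
  - intros x Hx. apply (continuous_comp a (fun y => Rpower y p)); [auto|].
    eapply is_derive_continuous, is_derive_Reals, derivable_pt_lim_power. auto.
  - pose proof (class_C_pred _ _ _ Ha) as Ha0. destruct Ha as [a' [Ha Ha']].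
    exists (fun x => p * Rpower (a x) (p - 1) * a' x). split.
    + intros x Hx. apply is_derive_Rpower_comp; auto.
    + repeat apply class_C_mult; auto using class_C_const.
Qed.

Lemma class_C_inv (I : R -> Prop) (n : nat) (a : R -> R) :
  open I -> (forall x, I x -> 0 < a x) -> class_C I n a ->
  class_C I n (fun x => / a x).
Proof.
  intros HI Hpos Ha.
  apply (class_C_ext I n (fun x => Rpower (a x) (- (1)))); auto using class_C_Rpower.
  intros x Hx. rewrite Rpower_Ropp, Rpower_1; auto.
Qed.

Lemma class_C_sqrt (I : R -> Prop) (n : nat) (a : R -> R) :
  open I -> (forall x, I x -> 0 < a x) -> class_C I n a ->
  class_C I n (fun x => sqrt (a x)).
Proof.
  intros HI Hpos Ha.
  apply (class_C_ext I n (fun x => Rpower (a x) (/ 2))); auto using class_C_Rpower.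
  intros x Hx. apply Rpower_sqrt; auto.
Qed.

Lemma class_C_pow (I : R -> Prop) (n k : nat) : class_C I n (fun x => x ^ k).
Proof.
  induction k as [|k IH]; simpl.
  - apply class_C_const.
  - apply class_C_mult; [apply class_C_id|exact IH].
Qed.

Lemma is_derive_cos_div (c x : R) :
  is_derive (fun y => cos (y / c)) x (- / c * sin (x / c)).
Proof. auto_derive; [trivial|]. unfold Rdiv. ring. Qed.

Lemma is_derive_sin_div (c x : R) :
  is_derive (fun y => sin (y / c)) x (/ c * cos (x / c)).
Proof. auto_derive; [trivial|]. unfold Rdiv. ring. Qed.

Lemma class_C_cos_sin_div (I : R -> Prop) (c : R) (n : nat) :
  class_C I n (fun y => cos (y / c)) /\ class_C I n (fun y => sin (y / c)).
Proof.
  induction n as [|n [IHc IHs]].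
  - split; intros x _; eapply is_derive_continuous.
    + apply is_derive_cos_div.
    + apply is_derive_sin_div.
  - split.
    + exists (fun x => - / c * sin (x / c)).
      split; [intros; apply is_derive_cos_div|].
      apply class_C_mult; auto using class_C_const.
    + exists (fun x => / c * cos (x / c)).
      split; [intros; apply is_derive_sin_div|].
      apply class_C_mult; auto using class_C_const.
Qed.

(** Both partial derivatives of a product of a function of [x] and a function of
    [y] are again such products, so the mixed partials never leave this form and
    smoothness reduces to one variable. *)
Lemma ex_diff_n_separable (I J : R -> Prop) (n : nat) :
  open I -> open J -> forall (a b : R -> R) (x y : R),
  class_C I n a -> class_C J n b -> I x -> J y ->
  ex_diff_n (fun u v => a u * b v) n x y.
Proof.
  intros HI HJ.
  assert (L : forall (x y : R) (P : R -> R -> Prop), I x -> J y ->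
    (forall u v, I u -> J v -> P u v) -> locally_2d P x y).
  { intros x y P Hx Hy HP.
    destruct (HI x Hx) as [e1 H1]. destruct (HJ y Hy) as [e2 H2].
    exists (mkposreal _ (Rmin_stable_in_posreal e1 e2)). simpl.
    intros u v Hu Hv. apply HP; [apply H1|apply H2].
    - exact (Rlt_le_trans _ _ _ Hu (Rmin_l _ _)).
    - exact (Rlt_le_trans _ _ _ Hv (Rmin_r _ _)). }
  induction n as [|n IH]; intros a b x y Ha Hb Hx Hy; split.
  all: try (apply continuity_2d_pt_mult;
    [apply continuity_1d_2d_pt_comp|apply continuity_1d_2d_pt_comp];
    try apply continuity_2d_pt_id1; try apply continuity_2d_pt_id2;
    apply continuity_pt_filterlim;
    [exact (class_C_continuous _ _ _ _ Ha Hx)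
    |exact (class_C_continuous _ _ _ _ Hb Hy)]).
  - exact Logic.I.
  - pose proof (class_C_pred _ _ _ Ha) as Ha0.
    pose proof (class_C_pred _ _ _ Hb) as Hb0.
    destruct Ha as [a' [Ha Ha']]. destruct Hb as [b' [Hb Hb']].
    assert (D1 : forall u v, I u ->
      is_derive (fun z => a z * b v) u (a' u * b v)).
    { intros u v Hu.
      exact (@is_derive_scal_l R_AbsRing R_NormedModule a u (a' u) (b v) (Ha u Hu)). }
    assert (D2 : forall u v, J v ->
      is_derive (fun z => a u * b z) v (a u * b' v)).
    { intros u v Hv. apply (is_derive_scal b); auto. }
    split; [exists (a' x * b y); auto|].
    split; [exists (a x * b' y); auto|].
    split.
    + apply (ex_diff_n_ext_loc (fun u v => a' u * b v)); [|auto].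
      apply L; auto. intros u v Hu Hv. symmetry. apply is_derive_unique. auto.
    + apply (ex_diff_n_ext_loc (fun u v => a u * b' v)); [|auto].
      apply L; auto. intros u v Hu Hv. symmetry. apply is_derive_unique. auto.
Qed.

Lemma open_between (x1 x2 : R) : open (fun x : R => x1 < x < x2).
Proof. apply @open_and; [apply open_gt|apply open_lt]. Qed.

Lemma smooth_on_strip (x1 x2 : R) (a b : R -> R) :
  (forall n, class_C (fun x => x1 < x < x2) n a) ->
  (forall n, class_C (fun _ => True) n b) ->
  smooth_on (strip x1 x2) (fun x y => a x * b y).
Proof.
  intros Ha Hb n x y H.
  apply (ex_diff_n_separable (fun x => x1 < x < x2) (fun _ => True)); auto.
  - apply open_between.
  - apply open_true.
Qed.

Lemma smooth_on_strip_fst (x1 x2 : R) (a : R -> R) :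
  (forall n, class_C (fun x => x1 < x < x2) n a) ->
  smooth_on (strip x1 x2) (fun x _ => a x).
Proof.
  intros Ha n x y H.
  apply (ex_diff_n_ext_loc (fun u v => a u * 1)).
  - apply locally_2d_forall. intros; ring.
  - apply (smooth_on_strip x1 x2 a (fun _ => 1)); auto using class_C_const.
Qed.

(** * Limits and differentials in products *)

Lemma filterlim_locally_pair {X : Type} {U V : UniformSpace}
  (F : (X -> Prop) -> Prop) {FF : Filter F} (a : X -> U) (b : X -> V)
  (u : U) (v : V) :
  filterlim a F (locally u) -> filterlim b F (locally v) ->
  filterlim (fun t => (a t, b t)) F (locally (u, v)).
Proof.
  intros Ha Hb. apply filterlim_locally. intros eps.
  apply (proj1 (filterlim_locally a u)) with (eps := eps) in Ha.
  apply (proj1 (filterlim_locally b v)) with (eps := eps) in Hb.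
  generalize (filter_and _ _ Ha Hb). apply filter_imp.
  intros t [H1 H2]. split; assumption.
Qed.

(** The pair is the sum of its two coordinate embeddings, which are linear. *)
Lemma filterdiff_pair {K : AbsRing} {U V W : NormedModule K}
  (F : (U -> Prop) -> Prop) {FF : Filter F} (a : U -> V) (b : U -> W)
  (la : U -> V) (lb : U -> W) :
  filterdiff a F la -> filterdiff b F lb ->
  filterdiff (fun t => (a t, b t)) F (fun t => (la t, lb t)).
Proof.
  intros Ha Hb.
  set (i1 := fun v : V => (v, zero) : prod_NormedModule K V W).
  set (i2 := fun w : W => (zero, w) : prod_NormedModule K V W).
  assert (L1 : is_linear i1)
    by (apply (is_linear_prod (fun v : V => v));
        [apply is_linear_id|apply is_linear_zero]).
  assert (L2 : is_linear i2)
    by (apply (is_linear_prod _ (fun w : W => w));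
        [apply is_linear_zero|apply is_linear_id]).
  assert (P : forall v w, plus (i1 v) (i2 w) = (v, w)).
  { intros v w. unfold i1, i2, plus. simpl. unfold prod_plus. simpl.
    now rewrite plus_zero_r, plus_zero_l. }
  apply (filterdiff_ext (fun t => plus (i1 (a t)) (i2 (b t)))); [auto|].
  apply (filterdiff_ext_lin _ (fun t => plus (i1 (la t)) (i2 (lb t)))); [|auto].
  apply filterdiff_plus_fct.
  - apply (filterdiff_comp a i1 la i1); auto. now apply filterdiff_linear.
  - apply (filterdiff_comp b i2 lb i2); auto. now apply filterdiff_linear.
Qed.

Lemma filterdiff_separable (a b : R -> R) (p : plane) (a' b' : R) :
  is_derive a (fst p) a' -> is_derive b (snd p) b' ->
  filterdiff (fun q : plane => a (fst q) * b (snd q)) (locally p)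
    (fun w : plane => fst w * (a' * b (snd p)) + snd w * (a (fst p) * b')).
Proof.
  intros Ha Hb.
  apply (filterdiff_ext_lin _ (fun w : plane =>
    plus (mult (scal (fst w) a') (b (snd p)))
         (mult (a (fst p)) (scal (snd w) b')))).
  - apply (@filterdiff_mult_fct R_AbsRing); [apply Rmult_comm| |].
    + apply (filterdiff_comp' fst a p fst (fun y => scal y a')); [|exact Ha].
      apply filterdiff_linear, is_linear_fst.
    + apply (filterdiff_comp' snd b p snd (fun y => scal y b')); [|exact Hb].
      apply filterdiff_linear, is_linear_snd.
  - intros [w1 w2]. unfold plus, mult, scal. simpl. unfold mult. simpl. ring.
Qed.

(** A vector killed by the differential has length zero for [g], hence is zero. *)
Lemma isometric_immersion (D : plane -> Prop) (g : metric) (p : plane -> space)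
  (x : plane) :
  riemannian_metric_on D g -> isometric_on D g p -> D x ->
  exists L : plane -> space,
    filterdiff p (locally x) L /\ forall u v, L u = L v -> u = v.
Proof.
  intros (_ & _ & _ & Hpos) Hiso Hx.
  destruct (Hiso x Hx) as (L & HL & Hdot). exists L. split; [exact HL|].
  intros u v E. destruct HL as [Hlin _].
  set (w := minus u v : plane).
  assert (W0 : L w = zero).
  { etransitivity; [exact (linear_minus L u v Hlin)|].
    rewrite E. apply (minus_eq_zero (L v)). }
  assert (Hw : w = (0, 0)).
  { destruct (Req_dec (fst w) 0) as [H1|H1];
      [destruct (Req_dec (snd w) 0) as [H2|H2]|].
    - rewrite (surjective_pairing w). now rewrite H1, H2.
    - exfalso. assert (N : w <> (0, 0)) by (intros N; now rewrite N in H2).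
      specialize (Hpos x w Hx N). rewrite <- Hdot, W0 in Hpos.
      unfold dot in Hpos. simpl in Hpos. unfold zero in Hpos. simpl in Hpos. lra.
    - exfalso. assert (N : w <> (0, 0)) by (intros N; now rewrite N in H1).
      specialize (Hpos x w Hx N). rewrite <- Hdot, W0 in Hpos.
      unfold dot in Hpos. simpl in Hpos. unfold zero in Hpos. simpl in Hpos. lra. }
  destruct u as [u1 u2], v as [v1 v2].
  unfold w, minus, plus, opp in Hw; simpl in Hw.
  unfold prod_plus, prod_opp, plus, opp in Hw; simpl in Hw.
  injection Hw. intros. f_equal; lra.
Qed.

(** * Topology of surfaces of revolution *)

Definition revolution (Cs : R) (z : R -> R) (p : plane) : space :=
  (Cs / fst p * cos (snd p / Cs), Cs / fst p * sin (snd p / Cs), z (fst p)).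

(** The open half of space bounded by a plane through the axis of revolution,
    around the meridian of angle [t]. *)
Definition half_space (t : R) (q : space) : Prop :=
  0 < fst (fst q) * cos t + snd (fst q) * sin t.

(** The points of the strip whose angle [y / Cs] is within a quarter turn of [t];
    this is one component of the preimage of [half_space t]. *)
Definition sheet (x1 x2 Cs t : R) (p : plane) : Prop :=
  x1 < fst p < x2 /\ - (PI / 2) < snd p / Cs - t < PI / 2.

(** The distance to the axis is [Cs / x], which recovers [x], and the angle is
    recovered from its tangent after rotating by [- t].  Only the
    horizontal coordinates are read, so one formula serves every profile. *)
Definition sheet_inverse (Cs t : R) (q : space) : plane :=
  let X := fst (fst q) in let Y := snd (fst q) in
  (Cs / sqrt (X ^ 2 + Y ^ 2),
   Cs * (t + atan ((Y * cos t - X * sin t) / (X * cos t + Y * sin t)))).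

Lemma continuous_XY (q : space) :
  continuous (fun r : space => fst (fst r)) q /\
  continuous (fun r : space => snd (fst r)) q.
Proof.
  split; (apply (continuous_comp fst); [apply continuous_fst|]).
  - apply continuous_fst.
  - apply continuous_snd.
Qed.

Lemma continuous_XY_comb (q : space) (c s : R) :
  continuous (fun r : space => fst (fst r) * c + snd (fst r) * s) q.
Proof.
  destruct (continuous_XY q) as [HX HY].
  apply @continuous_plus; apply @continuous_mult; auto using continuous_const.
Qed.

Lemma open_half_space (t : R) : open (half_space t).
Proof.
  apply (open_comp (fun q : space => fst (fst q) * cos t + snd (fst q) * sin t)
           (fun y => 0 < y)); [|apply open_gt].
  intros q _. apply continuous_XY_comb.
Qed.

Lemma open_strip (x1 x2 : R) : open (strip x1 x2).
Proof.
  apply (open_comp fst (fun x => x1 < x < x2)).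
  - intros p _. apply continuous_fst.
  - apply open_between.
Qed.

Lemma open_sheet (x1 x2 Cs t : R) : open (sheet x1 x2 Cs t).
Proof.
  apply open_and; [apply open_strip|].
  apply (open_comp (fun p : plane => snd p / Cs - t)
           (fun y => - (PI / 2) < y < PI / 2)).
  - intros p _. apply @continuous_minus; [|apply continuous_const].
    apply @continuous_mult; [apply continuous_snd|apply continuous_const].
  - apply open_between.
Qed.

Lemma half_space_sqr_pos (t : R) (q : space) :
  half_space t q -> 0 < fst (fst q) ^ 2 + snd (fst q) ^ 2.
Proof.
  unfold half_space. intros H.
  destruct (Req_dec (fst (fst q)) 0) as [E|E]; [|nra].
  destruct (Req_dec (snd (fst q)) 0) as [E'|E']; [|nra].
  rewrite E, E' in H. lra.
Qed.

Lemma sheet_inverse_continuous (Cs t : R) (q : space) :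
  half_space t q -> continuous (sheet_inverse Cs t) q.
Proof.
  intros H. destruct (continuous_XY q) as [HX HY].
  pose proof (half_space_sqr_pos t q H) as Hq. unfold half_space in H.
  assert (Hdiv : forall a b : space -> R, continuous a q -> continuous b q ->
    b q <> 0 -> continuous (fun r => a r / b r) q).
  { intros a b Ha Hb N. apply @continuous_mult; [exact Ha|].
    apply (continuous_comp b Rinv); [exact Hb|].
    apply continuity_pt_filterlim. apply (continuity_pt_inv (fun y => y)); [|exact N].
    apply continuity_pt_filterlim, continuous_id. }
  apply filterlim_locally_pair; [apply locally_filter| |].
  - apply Hdiv; [apply continuous_const| |].
    + apply (continuous_comp
        (fun r : space => fst (fst r) ^ 2 + snd (fst r) ^ 2) sqrt);
        [|apply continuous_sqrt].
      apply @continuous_plus; simpl; repeat apply @continuous_mult;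
        auto using continuous_const.
    + apply Rgt_not_eq, sqrt_lt_R0, Hq.
  - apply @continuous_mult; [apply continuous_const|].
    apply @continuous_plus; [apply continuous_const|].
    apply (continuous_comp (fun r : space =>
      (snd (fst r) * cos t - fst (fst r) * sin t)
      / (fst (fst r) * cos t + snd (fst r) * sin t)) atan);
      [|apply continuous_atan].
    apply Hdiv; [|apply continuous_XY_comb|lra].
    apply @continuous_minus; apply @continuous_mult; auto using continuous_const.
Qed.

(** Rotating a point of the surface by [- t] about the axis subtracts [t] from its
    angle; [half_space] and [sheet_inverse] are written in the rotated
    coordinates. *)
Lemma revolution_rotated (Cs t : R) (z : R -> R) (p : plane) :
  let q := revolution Cs z p in
  let X := fst (fst q) in let Y := snd (fst q) in
  X * cos t + Y * sin t = Cs / fst p * cos (snd p / Cs - t) /\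
  Y * cos t - X * sin t = Cs / fst p * sin (snd p / Cs - t) /\
  X ^ 2 + Y ^ 2 = (Cs / fst p) ^ 2.
Proof.
  simpl. rewrite cos_minus, sin_minus. split; [ring|]. split; [ring|].
  pose proof (sin2_cos2 (snd p / Cs)) as E. unfold Rsqr in E.
  transitivity ((Cs / fst p) ^ 2 * (sin (snd p / Cs) * sin (snd p / Cs)
    + cos (snd p / Cs) * cos (snd p / Cs))); [|rewrite E]; ring.
Qed.

Lemma revolution_half_space (x1 x2 Cs t : R) (z : R -> R) (p : plane) :
  0 < x1 -> 0 < Cs -> strip x1 x2 p ->
  half_space t (revolution Cs z p) <-> 0 < cos (snd p / Cs - t).
Proof.
  intros H1 HCs Hp. unfold half_space, strip in *.
  destruct (revolution_rotated Cs t z p) as (E & _). cbv zeta in E. rewrite E.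
  pose proof (Rdiv_lt_0_compat Cs (fst p) HCs ltac:(lra)).
  split; intros; [apply (Rmult_lt_reg_l (Cs / fst p)); lra|nra].
Qed.

Lemma revolution_in_own_half_space (x1 x2 Cs : R) (z : R -> R) (p : plane) :
  0 < x1 -> 0 < Cs -> strip x1 x2 p ->
  half_space (snd p / Cs) (revolution Cs z p).
Proof.
  intros H1 HCs Hp. apply (revolution_half_space x1 x2); auto.
  rewrite Rminus_diag, cos_0. lra.
Qed.

Lemma sheet_inverse_revolution (Cs t : R) (z : R -> R) (p : plane) :
  0 < Cs -> 0 < fst p -> 0 < cos (snd p / Cs - t) ->
  sheet_inverse Cs t (revolution Cs z p)
  = (fst p, Cs * (t + atan (tan (snd p / Cs - t)))).
Proof.
  intros HCs Hx Hc. pose proof (Rdiv_lt_0_compat Cs (fst p) HCs Hx) as Hf.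
  destruct (revolution_rotated Cs t z p) as (E1 & E2 & E3).
  unfold sheet_inverse. cbv zeta in E1, E2, E3 |- *.
  rewrite E1, E2, E3. rewrite sqrt_pow2 by lra.
  f_equal; [field; lra|].
  do 3 f_equal. unfold tan. field. lra.
Qed.

(** This one fact yields both the charts of the surface and the sheets of the
    covering.  The surface is embedded because [Cs / x] is injective in [x]. *)
Lemma sheet_homeomorphism (x1 x2 Cs t : R) (z : R -> R) :
  0 < x1 -> 0 < Cs -> continuous_on (strip x1 x2) (revolution Cs z) ->
  homeomorphism (sheet x1 x2 Cs t)
    (fun q => image (strip x1 x2) (revolution Cs z) q /\ half_space t q)
    (revolution Cs z).
Proof.
  intros H1 HCs Hcont.
  assert (Dir : forall p, sheet x1 x2 Cs t p -> 0 < cos (snd p / Cs - t))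
    by (intros p [_ Hp]; apply cos_gt_0; lra).
  split; [|split; [|exists (sheet_inverse Cs t); split; [|split; [|split]]]].
  - intros p [Hp Ht].
    split; [now exists p|].
    apply (revolution_half_space x1 x2); auto. apply cos_gt_0; lra.
  - apply (continuous_on_subset (strip x1 x2)); [|exact Hcont].
    intros p [Hp _]. exact Hp.
  - intros q [[p [Hp <-]] Hq]. unfold strip in Hp.
    rewrite sheet_inverse_revolution; auto;
      [|lra|now apply (revolution_half_space x1 x2 Cs t z)].
    split; [exact Hp|]. simpl.
    pose proof (atan_bound (tan (snd p / Cs - t))).
    replace (Cs * (t + atan (tan (snd p / Cs - t))) / Cs - t)
      with (atan (tan (snd p / Cs - t))) by (field; lra). lra.
  - intros q [_ Hq].
    eapply filterlim_filter_le_1; [apply filter_le_within|].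
    apply sheet_inverse_continuous, Hq.
  - intros p Hp. rewrite sheet_inverse_revolution; auto;
      [|destruct Hp; lra].
    destruct Hp as [_ Hp]. rewrite atan_tan by lra.
    destruct p as [x y]. simpl. f_equal. field. lra.
  - intros q [[p [Hp <-]] Hq]. 
    pose proof (proj1 (revolution_half_space x1 x2 Cs t z p H1 HCs Hp) Hq) as Hc.
    unfold strip in Hp.
    rewrite sheet_inverse_revolution; auto; [|lra].
    unfold revolution. simpl.
    set (d := snd p / Cs - t) in *.
    replace (Cs * (t + atan (tan d)) / Cs) with (t + atan (tan d))
      by (field; lra).
    replace (snd p / Cs) with (t + d) by (unfold d; ring).
    rewrite !cos_plus, !sin_plus, cos_atan, sin_atan.
    rewrite <- (Rtrigo_facts.cos_tan _ Hc), <- (Rtrigo_facts.sin_tan _ Hc).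
    reflexivity.
Qed.

Lemma cos_sin_2kPI (t : R) (k : Z) :
  cos (t + 2 * IZR k * PI) = cos t /\ sin (t + 2 * IZR k * PI) = sin t.
Proof.
  assert (S : sin (IZR k * PI) = 0) by (apply sin_eq_0_1; now exists k).
  rewrite cos_plus, sin_plus.
  replace (2 * IZR k * PI) with (2 * (IZR k * PI)) by ring.
  rewrite cos_2a_sin, sin_2a, S. split; ring.
Qed.

(** The multiple of [2 * PI] nearest to [d] works: the remainder lies between
    [- PI] and [PI], where the cosine is positive only on the middle half. *)
Lemma cos_pos_near_2kPI (d : R) :
  0 < cos d -> exists k : Z, - (PI / 2) < d - 2 * IZR k * PI < PI / 2.
Proof.
  intros Hc. pose proof PI_RGT_0 as HPI.
  set (k := up (d / (2 * PI) - / 2)).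
  destruct (archimed (d / (2 * PI) - / 2)) as [A1 A2]. fold k in A1, A2.
  exists k. set (e := d - 2 * IZR k * PI).
  assert (Ed : d / (2 * PI) * (2 * PI) = d) by (field; lra).
  assert (He : - PI <= e <= PI) by (unfold e; nra).
  assert (Hce : 0 < cos e).
  { destruct (cos_sin_2kPI e k) as [E _].
    rewrite <- E. unfold e. now replace (d - 2 * IZR k * PI + 2 * IZR k * PI) with d by ring. }
  split; apply Rnot_le_lt; intros N.
  - pose proof (cos_le_0 (- e)). rewrite cos_neg in H. lra.
  - pose proof (cos_le_0 e). lra.
Qed.

(** The half space around the meridian of a point is evenly covered, with sheets
    indexed by the number [k] of full turns: all the half spaces of angles
    [t + 2 * k * PI] coincide, while their sheets are disjoint. *)
Lemma revolution_covering (x1 x2 Cs : R) (z : R -> R) :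
  0 < x1 -> 0 < Cs -> continuous_on (strip x1 x2) (revolution Cs z) ->
  covering_map (strip x1 x2) (image (strip x1 x2) (revolution Cs z))
    (revolution Cs z).
Proof.
  intros H1 HCs Hcont. pose proof PI_RGT_0 as HPI.
  split; [intros p Hp; now exists p|]. split; [auto|]. split; [exact Hcont|].
  intros q [p [Hp <-]]. set (t := snd p / Cs).
  pose proof (fun p' => revolution_half_space x1 x2 Cs t z p' H1 HCs) as Hrot.
  exists (fun q => image (strip x1 x2) (revolution Cs z) q /\ half_space t q).
  split; [|split].
  - exists (half_space t). split; [apply open_half_space|tauto].
  - split; [now exists p|]. now apply (revolution_in_own_half_space x1 x2).
  - exists Z, (fun k => sheet x1 x2 Cs (t + 2 * IZR k * PI)).
    split; [|split; [|split]].
    + intros k. exists (sheet x1 x2 Cs (t + 2 * IZR k * PI)).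
      split; [apply open_sheet|]. unfold sheet, strip. tauto.
    + intros i j x [_ Hi] [_ Hj].
      assert (-1 < IZR (i - j) < 1) by (rewrite minus_IZR; nra).
      assert ((-1 < i - j < 1)%Z) by (split; apply lt_IZR; lra). lia.
    + intros x. split.
      * intros [Hx [_ Hv]]. apply Hrot in Hv; [|exact Hx].
        destruct (cos_pos_near_2kPI _ Hv) as [k Hk]. exists k.
        split; [exact Hx|lra].
      * intros [k [Hx Hk]]. split; [exact Hx|]. split; [now exists x|].
        apply Hrot; [exact Hx|].
        destruct (cos_sin_2kPI (snd x / Cs - (t + 2 * IZR k * PI)) k) as [E _].
        replace (snd x / Cs - (t + 2 * IZR k * PI) + 2 * IZR k * PI)
          with (snd x / Cs - t) in E by ring.
        pose proof (cos_gt_0 _ (proj1 Hk) (proj2 Hk)) as Hc.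
        exact (eq_ind_r (fun r => 0 < r) Hc E).
    + intros k.
      pose proof (sheet_homeomorphism x1 x2 Cs (t + 2 * IZR k * PI) z H1 HCs Hcont)
        as H.
      unfold half_space in H. destruct (cos_sin_2kPI t k) as [E1 E2].
      rewrite E1, E2 in H. exact H.
Qed.

(** The charts are the restrictions of the map to the sheets; their differentials
    are injective because the map is isometric. *)
Lemma revolution_regular (x1 x2 Cs : R) (z : R -> R) (g : metric) :
  0 < x1 -> 0 < Cs -> continuous_on (strip x1 x2) (revolution Cs z) ->
  smooth_map_on (strip x1 x2) (revolution Cs z) ->
  riemannian_metric_on (strip x1 x2) g ->
  isometric_on (strip x1 x2) g (revolution Cs z) ->
  regular_surface (image (strip x1 x2) (revolution Cs z)).
Proof.
  intros H1 HCs Hcont (S1 & S2 & S3) Hg Hiso q [p [Hp <-]].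
  set (t := snd p / Cs).
  exists (sheet x1 x2 Cs t), (half_space t), (revolution Cs z).
  split; [apply open_sheet|]. split; [apply open_half_space|].
  split; [|split; [now apply sheet_homeomorphism|split]].
  - now apply (revolution_in_own_half_space x1 x2).
  - repeat split; intros n x y [Hx _]; [apply S1|apply S2|apply S3]; exact Hx.
  - intros x [Hx _]. exact (isometric_immersion _ _ _ _ Hg Hiso Hx).
Qed.

(** * Simple connectedness of the strip *)

Definition segment (s : R) (p q : plane) : plane :=
  ((1 - s) * fst p + s * fst q, (1 - s) * snd p + s * snd q).

Lemma segment_0 (p q : plane) : segment 0 p q = p.
Proof. destruct p, q. unfold segment. simpl. f_equal; ring. Qed.

Lemma segment_1 (p q : plane) : segment 1 p q = q.
Proof. destruct p, q. unfold segment. simpl. f_equal; ring. Qed.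

Lemma segment_diag (s : R) (p : plane) : segment s p p = p.
Proof. destruct p. unfold segment. simpl. f_equal; ring. Qed.

Lemma strip_segment (x1 x2 s : R) (p q : plane) :
  strip x1 x2 p -> strip x1 x2 q -> 0 <= s <= 1 ->
  strip x1 x2 (segment s p q).
Proof.
  unfold strip, segment. simpl. intros Hp Hq [[Hs| <-] Hs']; [|lra].
  assert (0 < s * (fst q - x1)) by (apply Rmult_lt_0_compat; lra).
  assert (0 < s * (x2 - fst q)) by (apply Rmult_lt_0_compat; lra).
  assert (0 <= (1 - s) * (fst p - x1)) by (apply Rmult_le_pos; lra).
  assert (0 <= (1 - s) * (x2 - fst p)) by (apply Rmult_le_pos; lra).
  lra.
Qed.

Lemma filterlim_segment {X : Type} (F : (X -> Prop) -> Prop) {FF : Filter F}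
  (s : X -> R) (p q : X -> plane) (s0 : R) (p0 q0 : plane) :
  filterlim s F (locally s0) -> filterlim p F (locally p0) ->
  filterlim q F (locally q0) ->
  filterlim (fun x => segment (s x) (p x) (q x)) F (locally (segment s0 p0 q0)).
Proof.
  intros Hs Hp Hq.
  assert (C : forall a b : X -> R, forall a0 b0 : R,
    filterlim a F (locally a0) -> filterlim b F (locally b0) ->
    filterlim (fun x => (1 - s x) * a x + s x * b x) F
      (locally ((1 - s0) * a0 + s0 * b0))).
  { intros a b a0 b0 Ha Hb.
    apply (filterlim_comp_2 (G := locally ((1 - s0) * a0)) (H := locally (s0 * b0))
      (fun x => (1 - s x) * a x) (fun x => s x * b x) Rplus);
      [| |apply (filterlim_plus ((1 - s0) * a0) (s0 * b0))].
    - apply (filterlim_comp_2 (G := locally (1 - s0)) (H := locally a0)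
        (fun x => 1 - s x) a Rmult); [|exact Ha|apply (filterlim_mult (1 - s0) a0)].
      apply (filterlim_comp _ _ _ s (fun y => 1 - y) F (locally s0)); [exact Hs|].
      apply (continuous_minus (fun _ => 1) (fun y : R => y));
        [apply continuous_const|apply continuous_id].
    - apply (filterlim_comp_2 (G := locally s0) (H := locally b0) s b Rmult);
        [exact Hs|exact Hb|apply (filterlim_mult s0 b0)]. }
  assert (P1 : forall (r : X -> plane) r0, filterlim r F (locally r0) ->
    filterlim (fun x => fst (r x)) F (locally (fst r0))).
  { intros r r0 Hr. apply (filterlim_comp _ _ _ r fst F (locally r0)); [exact Hr|].
    apply (continuous_fst (fst r0) (snd r0)). }
  assert (P2 : forall (r : X -> plane) r0, filterlim r F (locally r0) ->
    filterlim (fun x => snd (r x)) F (locally (snd r0))).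
  { intros r r0 Hr. apply (filterlim_comp _ _ _ r snd F (locally r0)); [exact Hr|].
    apply (continuous_snd (fst r0) (snd r0)). }
  apply filterlim_locally_pair; auto.
Qed.

(** The strip is convex, so every loop contracts along segments to its base
    point. *)
Lemma simply_connected_strip (x1 x2 : R) :
  x1 < x2 -> simply_connected (strip x1 x2).
Proof.
  intros H12. split; [|split].
  - exists ((x1 + x2) / 2, 0). unfold strip. simpl. lra.
  - intros p q Hp Hq. exists (fun s => segment s p q).
    split; [|split; [|split; [apply segment_0|apply segment_1]]].
    + apply continuous_on_forall. intros s _.
      apply filterlim_segment; [apply locally_filter|apply filterlim_id| |];
        apply filterlim_const.
    + intros s Hs. now apply strip_segment.
  - intros c Hc Hin Hloop.
    exists (fun q => segment (fst q) (c (snd q)) (c 0)).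
    split; [|split; [|split; [|split]]].
    + intros [s u] [Hs Hu].
      apply filterlim_segment;
        [apply within_filter, locally_filter| | |apply filterlim_const].
      * eapply filterlim_filter_le_1; [apply filter_le_within|].
        apply (continuous_fst s u).
      * apply (filterlim_comp _ _ _ snd c _
          (within unit_interval (locally u))); [|now apply Hc].
        intros P HP. unfold within in HP.
        apply (continuous_snd s u) in HP.
        unfold filtermap, within in HP |- *. revert HP. apply filter_imp.
        intros q HP [_ Hq]. auto.
    + intros [s u] [Hs Hu]. apply strip_segment; auto. apply Hin.
      unfold unit_interval. lra.
    + intros u _. apply segment_0.
    + intros u _. apply segment_1.
    + intros s _. simpl. rewrite <- Hloop, segment_diag. auto.
Qed.

(** * Riemannian geometry of surfaces of revolution *)

Lemma is_derive_div (Cs x : R) :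
  x <> 0 -> is_derive (fun y => Cs / y) x (- Cs / x ^ 2).
Proof. intros Hx. auto_derive; [exact Hx|]. field. exact Hx. Qed.

(** The profile curve [(Cs / x, z x)] has squared speed
    [(Cs / x ^ 2) ^ 2 + z' x ^ 2], and the parallel at [x], of radius [Cs / x], is
    run through at angular speed [1 / Cs], which gives [1 / x ^ 2]. *)
Lemma revolution_isometric (x1 x2 Cs : R) (z z' : R -> R) (g : metric) :
  0 < x1 -> Cs <> 0 ->
  (forall x, x1 < x < x2 -> is_derive z x (z' x)) ->
  (forall x y, x1 < x < x2 -> coefE g x y = (Cs / x ^ 2) ^ 2 + z' x ^ 2) ->
  (forall x y, x1 < x < x2 -> coefF g x y = 0) ->
  (forall x y, x1 < x < x2 -> coefG g x y = 1 / x ^ 2) ->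
  isometric_on (strip x1 x2) g (revolution Cs z).
Proof.
  intros H1 HCs Hz HE HF HG [x y] Hx. unfold strip in Hx. simpl in Hx.
  assert (D1 : is_derive (fun u => Cs / u) x (- Cs / x ^ 2))
    by (apply is_derive_div; lra).
  eexists. split.
  - apply filterdiff_pair; [apply locally_filter|apply filterdiff_pair|].
    + apply locally_filter.
    + exact (filterdiff_separable (fun u => Cs / u) (fun v => cos (v / Cs))
               (x, y) _ _ D1 (is_derive_cos_div Cs y)).
    + exact (filterdiff_separable (fun u => Cs / u) (fun v => sin (v / Cs))
               (x, y) _ _ D1 (is_derive_sin_div Cs y)).
    + apply (filterdiff_comp' fst z (x, y) fst (fun w => scal w (z' x)));
        [apply filterdiff_linear, is_linear_fst|exact (Hz x Hx)].
  - intros [u1 u2] [v1 v2]. unfold dot, metric_at, scal. simpl fst. simpl snd.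
    rewrite HE, HF, HG by exact Hx. simpl. unfold mult. simpl.
    pose proof (sin2_cos2 (y / Cs)) as S. unfold Rsqr in S.
    set (c := cos (y / Cs)) in *. set (s := sin (y / Cs)) in *.
    transitivity (u1 * v1 * ((Cs / x ^ 2) ^ 2 * (s * s + c * c) + z' x ^ 2)
      + u2 * v2 * (1 / x ^ 2 * (s * s + c * c))).
    + field. lra.
    + rewrite S. field. lra.
Qed.

Lemma revolution_smooth (x1 x2 Cs : R) (z : R -> R) :
  0 < x1 -> (forall n, class_C (fun x => x1 < x < x2) n z) ->
  smooth_map_on (strip x1 x2) (revolution Cs z).
Proof.
  intros H1 Hz.
  assert (D : forall n, class_C (fun x => x1 < x < x2) n (fun x => Cs / x)).
  { intros n. apply class_C_mult; [apply class_C_const|].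
    apply class_C_inv; [apply open_between|intros x Hx; lra|apply class_C_id]. }
  split; [|split].
  - apply (smooth_on_strip x1 x2 (fun x => Cs / x) (fun y => cos (y / Cs)));
      [exact D|intros n; apply class_C_cos_sin_div].
  - apply (smooth_on_strip x1 x2 (fun x => Cs / x) (fun y => sin (y / Cs)));
      [exact D|intros n; apply class_C_cos_sin_div].
  - exact (smooth_on_strip_fst x1 x2 z Hz).
Qed.

Lemma isometric_continuous (D : plane -> Prop) (g : metric) (p : plane -> space) :
  isometric_on D g p -> continuous_on D p.
Proof.
  intros H. apply continuous_on_forall. intros x Hx.
  destruct (H x Hx) as (L & HL & _).
  exact (filterdiff_continuous p x (ex_intro _ L HL)).
Qed.

Lemma revolution_universal_cover (x1 x2 Cs : R) (z : R -> R) (g : metric) :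
  0 < x1 < x2 -> 0 < Cs ->
  (forall n, class_C (fun x => x1 < x < x2) n z) ->
  riemannian_metric_on (strip x1 x2) g ->
  isometric_on (strip x1 x2) g (revolution Cs z) ->
  riemannian_universal_cover (strip x1 x2) g
    (image (strip x1 x2) (revolution Cs z)) (revolution Cs z).
Proof.
  intros [H1 H12] HCs Hz Hg Hiso.
  pose proof (isometric_continuous _ _ _ Hiso) as Hc.
  pose proof (revolution_smooth x1 x2 Cs z H1 Hz) as Hs.
  split; [apply open_strip|]. split; [exact Hg|].
  split; [now apply (revolution_regular x1 x2 Cs z g)|].
  split; [now apply simply_connected_strip|].
  split; [now apply revolution_covering|].
  split; [exact Hs|exact Hiso].
Qed.

(** * The metric g_C *)

Lemma is_derive_primitive (x1 x2 x0 x : R) (q : R -> R) :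
  (forall y, x1 < y < x2 -> continuous q y) ->
  x1 < x0 < x2 -> x1 < x < x2 -> is_derive (RInt q x0) x (q x).
Proof.
  intros Hq H0 Hx. apply (is_derive_RInt q (RInt q x0) x0); [|auto].
  apply (filter_imp (fun y => x1 < y < x2)); [|now apply open_between].
  intros y Hy. apply @RInt_correct, @ex_RInt_continuous.
  intros w Hw. apply Hq.
  unfold Rmin, Rmax in Hw. destruct (Rle_dec x0 y); lra.
Qed.

Lemma class_C_T (x1 x2 C : R) (n : nat) :
  0 < x1 -> class_C (fun x => x1 < x < x2) n (T C).
Proof.
  intros H1.
  apply (class_C_ext _ n (fun x => (-1 * Rpower x (8 / 3) + 3 * C * x ^ 2) + -3)).
  - apply open_between.
  - intros x _. unfold T. ring.
  - repeat apply class_C_plus; try apply class_C_mult;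
      auto using class_C_const, class_C_pow.
    apply class_C_Rpower; [intros x Hx; lra|apply class_C_id].
Qed.

Lemma g_C_riemannian (C x1 x2 : R) :
  0 < x1 -> (forall x, x1 < x < x2 -> 0 < T C x) ->
  riemannian_metric_on (strip x1 x2) (g_C C).
Proof.
  intros H1 HT.
  assert (HT2 : forall x, x1 < x < x2 -> 0 < x ^ 2 * T C x)
    by (intros x Hx; apply Rmult_lt_0_compat; [apply pow_lt; lra|auto]).
  split; [|split; [|split]].
  - apply (smooth_on_strip_fst x1 x2 (fun x => 3 / (x ^ 2 * T C x))). intros n.
    apply class_C_mult; [apply class_C_const|].
    apply class_C_inv; [apply open_between|exact HT2|].
    apply class_C_mult; [apply class_C_pow|now apply class_C_T].
  - apply (smooth_on_strip_fst x1 x2 (fun _ => 0)). intros n. apply class_C_const.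
  - apply (smooth_on_strip_fst x1 x2 (fun x => 1 / x ^ 2)). intros n.
    apply class_C_mult; [apply class_C_const|].
    apply class_C_inv; [apply open_between|intros x Hx; apply pow_lt; lra|apply class_C_pow].
  - intros [x y] [u v] Hx Hu. unfold strip in Hx. simpl in Hx.
    assert (HE : 0 < 3 / (x ^ 2 * T C x))
      by (apply Rdiv_lt_0_compat; [lra|auto]).
    assert (HG : 0 < 1 / x ^ 2) by (apply Rdiv_lt_0_compat; [lra|apply pow_lt; lra]).
    change (0 < 3 / (x ^ 2 * T C x) * (u * u) + 0 * (u * v + v * u)
                + 1 / x ^ 2 * (v * v)).
    set (e := 3 / (x ^ 2 * T C x)) in *. set (k := 1 / x ^ 2) in *.
    destruct (Req_dec u 0) as [->|Nu].
    + assert (Nv : v <> 0) by (intros ->; now apply Hu).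
      assert (0 < v * v) by nra. nra.
    + assert (0 < u * u) by nra. assert (0 <= v * v) by nra. nra.
Qed.

Theorem theorem4p9 (C xi01 xi02 Cs xi00 sgn a : R)
  (hC : C_min < C)
  (hxi : 0 < xi01 < xi02)
  (hxi01 : T C xi01 = 0)
  (hxi02 : T C xi02 = 0)
  (hCs : 0 < Cs < Rpower (C - C_min) (- (1 / 2)))
  (hxi00 : xi01 < xi00 < xi02)
  (hsgn : sgn = 1 \/ sgn = -1) :
  riemannian_universal_cover
    (strip xi01 xi02) (g_C C)
    (image (strip xi01 xi02) (Psi C Cs xi00 sgn a))
    (Psi C Cs xi00 sgn a).
Proof.
  destruct hxi as [h1 h12].
  assert (HT : forall x, xi01 < x < xi02 -> 0 < T C x)
    by (intros x Hx; now apply (T_pos C xi01 xi02)).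
  set (r := fun x => (3 * x ^ 2 - Cs ^ 2 * T C x) / (x ^ 4 * T C x)).
  assert (HxT : forall x, xi01 < x < xi02 -> 0 < x ^ 4 * T C x)
    by (intros x Hx; apply Rmult_lt_0_compat; [apply pow_lt; lra|auto]).
  assert (Hr : forall x, xi01 < x < xi02 -> 0 < r x).
  { intros x Hx. apply Rdiv_lt_0_compat; [|auto].
    apply radicand_pos; auto. lra. }
  assert (Cr : forall n, class_C (fun x => xi01 < x < xi02) n (fun x => sqrt (r x))).
  { intros n. apply class_C_sqrt; [apply open_between|exact Hr|].
    apply class_C_mult.
    - apply (class_C_ext _ n (fun x => 3 * x ^ 2 + - Cs ^ 2 * T C x)).
      + apply open_between.
      + intros x _. ring.
      + apply class_C_plus; apply class_C_mult;
          auto using class_C_const, class_C_pow, class_C_T.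
    - apply class_C_inv; [apply open_between|exact HxT|].
      apply class_C_mult; auto using class_C_pow, class_C_T. }
  assert (Dz : forall x, xi01 < x < xi02 ->
    is_derive (h C Cs xi00 sgn a) x (sgn * sqrt (r x))).
  { intros x Hx. rewrite <- (Rplus_0_r (sgn * sqrt (r x))).
    apply @is_derive_plus; [|apply @is_derive_const].
    apply is_derive_scal.
    apply (is_derive_primitive xi01 xi02 xi00 x (fun t => sqrt (r t))); auto.
    intros y Hy. exact (class_C_continuous _ 0 _ _ (Cr 0%nat) Hy). }
  apply (revolution_universal_cover xi01 xi02 Cs (h C Cs xi00 sgn a)).
  - split; assumption.
  - apply hCs.
  - intros n. apply class_C_pred. exists (fun x => sgn * sqrt (r x)).
    split; [exact Dz|]. apply class_C_mult; [apply class_C_const|apply Cr].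
  - now apply g_C_riemannian.
  - apply (revolution_isometric xi01 xi02 Cs _ (fun x => sgn * sqrt (r x)));
      [exact h1|lra|exact Dz| |reflexivity|reflexivity].
    intros x y Hx. simpl coefE.
    assert (E : (sgn * sqrt (r x)) ^ 2 = r x).
    { rewrite Rpow_mult_distr, pow2_sqrt by (apply Rlt_le; auto).
      destruct hsgn as [-> | ->]; ring. }
    (* the choice of r is what makes (Cs / x ^ 2) ^ 2 + r x = 3 / (x ^ 2 * T C x) *)
    rewrite E. unfold r. specialize (HT x Hx). field. lra.
Qed.
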